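(* Let $V$ be a four-dimensional real vector space with a metric tensor $g$ of signature $(-+++)$ and let $c>0$. Let $P,R\in V$ with $P^2=R^2=-1$, let $\mathbf{v}\in V$ satisfy $P\cdot\mathbf{v}=0$ and $\mathbf{v}^2<c^2$, and put $\gamma_{\mathbf v}=(1-\mathbf v^2/c^2)^{-1/2}$, $\overline{\mathbf v}=\gamma_{\mathbf v}\mathbf v/c$. Let $L=L_{P\wedge\overline{\mathbf v}}$ be the Lorentz boost generated by the bivector $P\wedge\overline{\mathbf v}$. Let $e\in V$ and define the coordinates $(ct,\mathbf x)$ and $(ct',\mathbf x')$ of $e$ by $$e=ct\,R+\mathbf x,\qquad L^{-1}e=ct'\,R+\mathbf x',\qquad R\cdot\mathbf x=R\cdot\mathbf x'=0 .$$ Define the scalars $$\nu e=ct\{(\gamma_{\mathbf v}-1)P\cdot R+\overline{\mathbf v}\cdot R\}+\overline{\mathbf v}\cdot\mathbf x+(\gamma_{\mathbf v}-1)P\cdot\mathbf x,$$ $$\xi e=ct\left(P\cdot R+\frac{\overline{\mathbf v}\cdot R}{\gamma_{\mathbf v}+1}\right)+\frac{\overline{\mathbf v}\cdot\mathbf x}{\gamma_{\mathbf v}+1}+P\cdot\mathbf x .$$ Then $$(\mathrm{id}-L^{-1})e=(\nu e)P-(\xi e)\overline{\mathbf v},$$ $$ct'=ct+R\cdot\{(\nu e)P-(\xi e)\overline{\mathbf v}\},\qquad \mathbf x'=\mathbf x-(\mathrm{id}-r)\{(\nu e)P-(\xi e)\overline{\mathbf v}\},$$ where $r=-R\otimes 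gR$.
   Context: Notation: $A\cdot B=g(A,B)$, $A^2=A\cdot A$; $gA\in V^*$ is the covector $B\mapsto A\cdot B$; for $A\in V$, $\alpha\in V^*$, $A\otimes\alpha$ is the endomorphism $B\mapsto\alpha(B)A$. Thus $r$ is the idempotent $B\mapsto -(R\cdot B)R$. For $P^2=-1$, $P\cdot\mathbf v=0$, $\mathbf v^2<c^2$, the Lorentz boost generated by $P\wedge\overline{\mathbf v}$ is $$L_{P\wedge\overline{\mathbf v}}=\mathrm{id}-(\gamma_{\mathbf v}-1)P\otimes gP+P\otimes g\overline{\mathbf v}-\overline{\mathbf v}\otimes gP+\frac{1}{\gamma_{\mathbf v}+1}\,\overline{\mathbf v}\otimes g\overline{\mathbf v}.$$ It is a $g$-isometry and $(L_{P\wedge\overline{\mathbf v}})^{-1}=L_{P\wedge(-\overline{\mathbf v})}$. *)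

(* Defs.v *)
From HB Require Import structures.
From mathcomp Require Import all_boot all_order all_algebra.
From mathcomp Require Import reals.

Set Implicit Arguments.
Unset Strict Implicit.
Unset Printing Implicit Defensive.

Import Order.TTheory GRing.Theory Num.Theory.
Local Open Scope ring_scope.

Section Lorentz.
Variables (K : realType) (V : vectType K) (g : {symmetric V}).

(* There is a g-orthonormal basis with one vector of square -1 and three of
   square 1; this includes nondegeneracy of g. *)
Definition lorentzian : Prop :=
  exists E : 4.-tuple V, basis_of fullv E /\
    forall i j : 'I_4,
      g (tnth E i) (tnth E j) =
        if i == j then (if i == ord0 then -1 else 1) else 0.

Definition flat (A : V) : 'Hom(V, K^o) := linfun (g A : V -> K^o).

Definition tensor (A : V) (alpha : 'Hom(V, K^o)) : 'End(V) :=
  linfun (fun B : V => (alpha B : K) *: A).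

(* [linfun] is only meaningful on linear maps, whence the next two lemmas. *)
Lemma flatE A B : flat A B = g A B.
Proof. by rewrite /flat (lfunE (g A : {linear V -> K^o})). Qed.

Lemma tensorE A alpha B : tensor A alpha B = (alpha B : K) *: A.
Proof.
have lin : linear (fun B : V => (alpha B : K) *: A).
  by move=> k u w; rewrite linearP scalerDl -scalerA.
pose m := GRing.isLinear.Build _ _ _ _ _ lin.
pose f : {linear V -> V} := HB.pack (fun B : V => (alpha B : K) *: A) m.
exact: (lfunE f).
Qed.

Definition gamma (c : K) (v : V) : K := (Num.sqrt (1 - g v v / c ^+ 2))^-1.

Definition vbar (c : K) (v : V) : V := (gamma c v / c) *: v.

(* The boost generated by the bivector P /\ vbar c v. *)
Definition lorentz_boost (c : K) (P v : V) : 'End(V) :=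
  let w := vbar c v in
  \1%VF - (gamma c v - 1) *: tensor P (flat P) + tensor P (flat w)
    - tensor w (flat P) + (gamma c v + 1)^-1 *: tensor w (flat w).

(* The scalars written [nu e] and [xi e], in terms of the coordinates
   (c t, x) of e relative to R. *)
Definition nu (c : K) (P R v : V) (t : K) (x : V) : K :=
  let w := vbar c v in
  c * t * ((gamma c v - 1) * g P R + g w R) + g w x
    + (gamma c v - 1) * g P x.

Definition xi (c : K) (P R v : V) (t : K) (x : V) : K :=
  let w := vbar c v in
  c * t * (g P R + g w R / (gamma c v + 1)) + g w x / (gamma c v + 1) + g P x.

(* The projection r onto the line of R along its g-orthogonal, when R^2 = -1. *)
Definition rproj (R : V) : 'End(V) := - tensor R (flat R).

End Lorentz.

(* Main.v *)
Require Import Defs.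
From mathcomp Require Import all_boot all_order all_algebra.
From mathcomp Require Import reals.
From mathcomp Require Import ring.

Import Order.TTheory GRing.Theory Num.Theory.
Local Open Scope ring_scope.

(** The boost moves a vector B only inside the plane spanned by P and vbar, by
    an amount linear in P.B and vbar.B. Since vbar^2 = gamma^2 - 1, the boost
    generated by -v is a left inverse, so L is injective and L^-1 is that boost;
    its explicit displacement evaluated at e = ct R + x is the claim. *)

Section Boost.
Variables (K : realType) (V : vectType K) (g : {symmetric V}).
Implicit Types (c : K) (A B P R v x : V).

Lemma formC A B : g A B = g B A.
Proof. by rewrite hermC /= expr0 mul1r. Qed.

Lemma formZr (a : K) A B : g A (a *: B) = a * g A B.
Proof. exact: linearZ. Qed.

Lemma formZl (a : K) A B : g (a *: A) B = a * g A B.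
Proof. by rewrite formC formZr formC. Qed.

Lemma gammaN c v : gamma g c (- v) = gamma g c v.
Proof. by rewrite /gamma linearNr linearNl opprK. Qed.

Lemma vbarN c v : vbar g c (- v) = - vbar g c v.
Proof. by rewrite /vbar gammaN scalerN. Qed.

Lemma gamma_gt0 c v : 0 < c -> g v v < c ^+ 2 -> 0 < gamma g c v.
Proof.
move=> c0 vc.
by rewrite invr_gt0 sqrtr_gt0 subr_gt0 ltr_pdivrMr ?exprn_gt0 // mul1r.
Qed.

Lemma form_vbar c v : 0 < c -> g v v < c ^+ 2 ->
  g (vbar g c v) (vbar g c v) = gamma g c v ^+ 2 - 1.
Proof.
move=> c0 vc; rewrite formZl formZr.
(* [g v v / c ^+ 2] is written as one minus the radicand of [gamma]; the inverse of that radicand is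
   [gamma ^+ 2], so the product collapses. *)
have -> : gamma g c v / c * (gamma g c v / c * g v v)
    = gamma g c v ^+ 2 * (1 - (1 - g v v / c ^+ 2)).
  by field; rewrite gt_eqF.
have s0 : 0 < 1 - g v v / c ^+ 2.
  by rewrite subr_gt0 ltr_pdivrMr ?exprn_gt0 // mul1r.
rewrite /gamma exprVn sqr_sqrtr ?ltW //.
by rewrite mulrBr mulr1 mulVf // gt_eqF.
Qed.

(** Collecting the rank-one terms along [P] and [vbar] leaves two scalar coefficients, so composing
    boosts reduces to scalar algebra. *)
Lemma lorentz_boostE c P v B (a := g P B) (b := g (vbar g c v) B) :
  lorentz_boost g c P v B
    = B + ((b - (gamma g c v - 1) * a) *: P
           + (b / (gamma g c v + 1) - a) *: vbar g c v).
Proof.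
rewrite /lorentz_boost /=; move: (vbar g c v) @b => w b.
rewrite !(add_lfunE, opp_lfunE, scale_lfunE, id_lfunE) !tensorE !flatE.
rewrite -/a -/b !scalerA [in RHS]scalerBl [in RHS](scalerBl (b / _)) [b / _]mulrC.
by rewrite [_ *: P - _]addrC [_ *: w - _]addrC !addrA.
Qed.

Lemma lorentz_boostK c P v : 0 < c -> g P P = -1 -> g P v = 0 ->
  g v v < c ^+ 2 -> cancel (lorentz_boost g c P v) (lorentz_boost g c P (- v)).
Proof.
move=> c0 PP Pv vc B.
have gam0 : gamma g c v + 1 != 0.
  by rewrite gt_eqF // addr_gt0 ?gamma_gt0.
have ww := form_vbar c v c0 vc.
have Pw : g P (vbar g c v) = 0 by rewrite formZr Pv mulr0.
have wP : g (vbar g c v) P = 0 by rewrite formC.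
rewrite [LHS]lorentz_boostE gammaN vbarN [in LHS]lorentz_boostE.
move: (vbar g c v) (gamma g c v) ww Pw wP gam0 => w k ww Pw wP gam0.
rewrite !linearNl !linearDr /= !formZr PP Pw wP ww scalerN -scaleNr.
(* [al], [be] are the coefficients of the first displacement, [al'], [be'] those of the second, with
   the sign of [- w] absorbed in [be']. They cancel because [P], [w] are orthogonal with squares -1
   and k^2 - 1, and (k^2 - 1)/(k + 1) = k - 1. *)
set al := _ - _ * g P B; set be := _ / _ - g P B.
set al' := (X in _ + (X *: P + _)); set be' := (X in _ + (_ + X *: w)).
have -> : al' = - al by rewrite /al' /al /be; field.
have -> : be' = - be by rewrite /be' /al /be; field.
by rewrite !scaleNr -opprD addrK.
Qed.

Lemma lorentz_boost_inv c P v : 0 < c -> g P P = -1 -> g P v = 0 ->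
  g v v < c ^+ 2 -> (lorentz_boost g c P v)^-1%VF =1 lorentz_boost g c P (- v).
Proof.
move=> c0 PP Pv vc B.
(* Cancellation at [- v] makes the opposite boost a right inverse too. Writing [B] as an image of
   the boost lets injectivity cancel [^-1], in general only a pseudo-inverse. *)
have LNK : lorentz_boost g c P v (lorentz_boost g c P (- v) B) = B.
  rewrite -{1}[v]opprK lorentz_boostK //.
    by rewrite -scaleN1r formZr Pv mulr0.
  by rewrite linearNr linearNl opprK.
rewrite -{1}LNK lker0_lfunK //; apply/lker0P.
exact: can_inj (lorentz_boostK _ _ _ c0 PP Pv vc).
Qed.

(** With a = P.e and b = vbar.e, the sign flip of [vbar] gives the coefficients b + (gamma - 1) a
    and -(a + b/(gamma + 1)); splitting [e] along [R] and [x] turns them into [nu] and [- xi]. *)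
Lemma lorentz_boostN_disp c P R v (t : K) x (e := (c * t) *: R + x) :
  e - lorentz_boost g c P (- v) e
    = nu g c P R v t x *: P - xi g c P R v t x *: vbar g c v.
Proof.
rewrite lorentz_boostE gammaN vbarN opprD addNKr opprD -scaleNr scalerN opprK.
rewrite -[in RHS]scaleNr !linearNl /e !linearDr /= !formZr.
by congr (_ *: _ + _ *: _); rewrite /nu /xi; ring.
Qed.

End Boost.

Theorem mainTheorem4 (K : realType) (V : vectType K) (g : {symmetric V})
    (c : K) (P R v e x x' : V) (t t' : K) :
  \dim {:V} = 4%N -> lorentzian g -> 0 < c ->
  g P P = -1 -> g R R = -1 ->
  g P v = 0 -> g v v < c ^+ 2 ->
  let L := lorentz_boost g c P v in
  let w := vbar g c v in
  e = (c * t) *: R + x -> g R x = 0 ->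
  (L^-1)%VF e = (c * t') *: R + x' -> g R x' = 0 ->
  let d := nu g c P R v t x *: P - xi g c P R v t x *: w in
  [/\ (\1%VF - (L^-1)%VF) e = d,
      c * t' = c * t + g R d &
      x' = x - (\1%VF - rproj g R) d].
Proof.
move=> _ _ c0 PP RR Pv vc L w eE Rx LeE Rx' d.
have dE : e - (L^-1)%VF e = d.
  by rewrite lorentz_boost_inv // eE lorentz_boostN_disp.
(* Pairing e - L^-1 e with [R] kills [x] and [x'], and R^2 = -1 leaves ct' - ct. *)
have tE : c * t' = c * t + g R d.
  by rewrite -dE LeE eE linearBr !linearDr /= !formZr RR Rx Rx'; ring.
split=> //; first by rewrite !(add_lfunE, opp_lfunE, id_lfunE).
(* The map id - r sends d to d + (R.d) R, which cancels the [R] component of d and leaves x - x'. *)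
rewrite /rproj !(add_lfunE, opp_lfunE, id_lfunE) tensorE flatE opprK.
have -> : g R d = c * t' - c * t by rewrite tE addrC addKr.
rewrite -dE LeE eE scalerBl.
set p := (c * t) *: R; set q := (c * t') *: R.
have -> : p + x - (q + x') + (q - p) = x - x'.
  by rewrite opprD (addrACA p) -(opprB p q) [LHS]addrC addKr.
by rewrite subKr.
Qed.
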